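(* Let $E$ be a Banach lattice and let $S,T\in\mathcal L(E)$ be such that $0\le S\le T$. Further suppose that $S$ is irreducible and that $T^k$ is compact for some $k\in\mathbb N$. Then $\operatorname{r}(S)\le\operatorname{r}(T)$, with equality if and only if $S=T$.
   Context: $\operatorname{r}(S):=\sup\{|\lambda|:\lambda\in\sigma(S)\}$ is the spectral radius. For operators, $0\le S$ means $SE_+\subseteq E_+$ (positive cone $E_+$), and $S\le T$ means $T-S\ge0$. A non-zero positive operator $S\in\mathcal L(E)$ is called irreducible if every closed ideal $J$ of $E$ with $S(J)\subseteq J$ satisfies $J=\{0\}$ or $J=E$; equivalently, for all $0<u\in E$ and $0<\varphi\in E'$ there exists $n\in\mathbb N$ with $\langle S^nu,\varphi\rangle>0$ (where $u>0$ means $u\ge0$ and $u\ne0$). *)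

(* Defs.v *)
From HB Require Import structures.
From mathcomp Require Import all_boot all_order all_algebra.
From mathcomp Require Import all_classical all_reals all_analysis.
From mathcomp Require Import complex.
Set Implicit Arguments.
Unset Strict Implicit.
Unset Printing Implicit Defensive.
Import Order.TTheory GRing.Theory Num.Theory.
Import numFieldNormedType.Exports.
Local Open Scope classical_set_scope.
Local Open Scope ring_scope.

(* The order has its own operation: Hierarchy Builder rejects the join of
   NormedModule with the structures of Order, because Num.NumDomain is declared
   before it and already joins Order and Num.SemiNormedZmodule. *)
HB.mixin Record NormedModule_isNormedRiesz (R : realType) E
    & NormedModule R E := {
  vle : rel E ;
  vjoin : E -> E -> E ;
  vle_refl : reflexive vle ;
  vle_anti : antisymmetric vle ;
  vle_trans : transitive vle ;
  vle_joinl : forall x y, vle x (vjoin x y) ;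
  vle_joinr : forall x y, vle y (vjoin x y) ;
  vjoin_le : forall x y z, vle x z -> vle y z -> vle (vjoin x y) z ;
  vle_add : forall z x y, vle x y -> vle (z + x) (z + y) ;
  vle_scale : forall (a : R) x, 0 <= a -> vle 0 x -> vle 0 (a *: x) ;
  norm_vle : forall x y,
    vle (vjoin x (- x)) (vjoin y (- y)) -> `|x| <= `|y|
}.

#[short(type="banachLatticeType")]
HB.structure Definition BanachLattice (R : realType) :=
  {E of CompleteNormedModule R E & NormedModule_isNormedRiesz R E}.

Definition modulus (R : realType) (E : banachLatticeType R) (x : E) : E :=
  vjoin x (- x).

Section Operators.
Context {R : realType} {E : banachLatticeType R}.
Implicit Types (f g : E -> E) (J : set E).

Definition op_ge0 f : Prop := forall x, vle 0 x -> vle 0 (f x).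

Definition op_le f g : Prop := op_ge0 (fun x => g x - f x).

Definition lattice_ideal J : Prop :=
  [/\ J 0,
      forall (a : R) x y, J x -> J y -> J (a *: x + y) &
      forall x y, J y -> vle (modulus x) (modulus y) -> J x].

Definition irreducible_op f : Prop :=
  [/\ exists x, f x != 0, op_ge0 f &
      forall J, lattice_ideal J -> closed J -> f @` J `<=` J ->
        J = [set 0] \/ J = setT].

Definition compact_op f : Prop := precompact (f @` [set x : E | `|x| <= 1]).

End Operators.

(* E + iE, with the product topology; every norm used on the complexification
   of a Banach lattice, such as the norm of the complex modulus, induces that
   topology. *)
Definition complexification (E : Type) : Type := (E * E)%type.

Section Complexification.
Context {R : realType} {E : normedModType R}.

HB.instance Definition _ := GRing.Zmodule.copy (complexification E) (E * E)%type.
HB.instance Definition _ :=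
  Topological.copy (complexification E) (E * E)%type.

Definition complexification_scale (l : R[i]) (z : complexification E) :
    complexification E :=
  (complex.Re l *: z.1 - complex.Im l *: z.2,
   complex.Re l *: z.2 + complex.Im l *: z.1).

Let scaleA l m (z : complexification E) :
  complexification_scale l (complexification_scale m z) =
  complexification_scale (l * m) z.
Proof.
case: l m z => [a b] [c d] [x y]; rewrite /complexification_scale/=.
by congr pair; rewrite !(scalerBr, scalerDr, scalerDl, scalerBl, scaleNr, scalerA);
  rewrite ?opprD !addrA [LHS]addrAC; congr (_ + _); rewrite addrAC.
Qed.

Let scale1 : left_id 1 complexification_scale.
Proof.
by move=> [x y]; rewrite /complexification_scale/= !scale1r !scale0r subr0 addr0.
Qed.

Let scaleDr : right_distributive complexification_scale +%R.
Proof.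
move=> [a b] [x y] [x' y']; rewrite /complexification_scale/=.
by congr pair; rewrite !scalerDr ?opprD addrACA.
Qed.

Let scaleDl (z : complexification E) :
  {morph complexification_scale^~ z : l m / l + m}.
Proof.
move=> [a b] [c d]; case: z => x y; rewrite /complexification_scale/=.
by congr pair; rewrite !scalerDl ?opprD addrACA.
Qed.

HB.instance Definition _ := GRing.Zmodule_isLmodule.Build R[i]
  (complexification E) scaleA scale1 scaleDr scaleDl.

Definition complexify (f : E -> E) (z : complexification E) :
  complexification E := (f z.1, f z.2).

End Complexification.

(* For linear f, an inverse g of l - f is automatically linear. *)
Definition resolvent_set (K : numFieldType) (V : preTopologicalLmodType K)
    (f : V -> V) : set K :=
  [set l | exists g : V -> V,
    [/\ continuous g, cancel (fun v => l *: v - f v) g &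
        cancel g (fun v => l *: v - f v)]].

Definition spectrum (K : numFieldType) (V : preTopologicalLmodType K)
  (f : V -> V) : set K := ~` resolvent_set f.

(* The spectrum of an operator on a real space is that of its complexification.
   The supremum is taken in \bar R because sup has a default value on empty or
   unbounded sets. *)
Definition spectral_radius (R : realType) (E : normedModType R) (f : E -> E) :
    \bar R :=
  ereal_sup [set (Normc.normc l)%:E |
              l in spectrum (complexify f : complexification E -> _)].

(* Main.v *)
(* Let rho f be the exponential growth rate inf {l > 0 | ||f^n|| = O(l^n)}. A
   Neumann series on the complexification shows that the spectral radius is at
   most rho, and rho S <= rho T because 0 <= S <= T.

   - rho T > 0 (de Pagter). If A dominates enough of the positive commutant of
     T, compactness of K = T^k makes u |-> x0 /\ A (K u) map a neighbourhood of
     x0 in [0, x0] into itself; the iterates of x0 stay away from 0 and lie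
     below A^m K^m x0, so ||K^m|| decays at most geometrically.

   - For r = rho f > 0 the resolvents of a positive f blow up as l decreases to
     r, so their normalizations P_n satisfy f P_n - r P_n -> 0. For f = T,
     compactness gives a pointwise limit P <> 0 along an ultrafilter, with
     T P = P T = r P. In particular r is an eigenvalue of T, hence its spectral
     radius.

   - Suppose rho S = rho T = r, and let u_n be normalized positive vectors with
     S u_n - r u_n -> 0, taken from the P_n for f = S. Only powers of T are
     compact, but P, strictly positive by irreducibility, forces
     T^k (T^k u_n - S^k u_n) -> 0, so u_n converges to some v > 0 with S v = r v.
     Then P (T v - S v) = 0, so T v = S v, and the ideal generated by v is
     dense. *)
Require Import Defs.
From HB Require Import structures.
From mathcomp Require Import all_boot all_order all_algebra.
From mathcomp Require Import all_classical all_reals all_analysis.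
From mathcomp Require Import complex ring lra.
Import Order.TTheory GRing.Theory Num.Theory.
Import numFieldNormedType.Exports.
Local Open Scope classical_set_scope.
Local Open Scope ring_scope.

Set Implicit Arguments.
Unset Strict Implicit.
Unset Printing Implicit Defensive.

Local Notation "x <=v y" := (vle x y) (at level 70, no associativity).

(** * Banach lattices *)

Section BanachLattice.
Context {R : realType} {E : banachLatticeType R}.
Implicit Types (x y z u v : E) (a : R).

Lemma vle_subE x y : (x <=v y) = (0 <=v y - x).
Proof.
apply/idP/idP => [/(vle_add (- x))|/(vle_add x)].
  by rewrite addNr addrC.
by rewrite addr0 addrC subrK.
Qed.

Lemma vletrans y x z : x <=v y -> y <=v z -> x <=v z.
Proof. exact: vle_trans. Qed.

Lemma vleD x y u v : x <=v y -> u <=v v -> x + u <=v y + v.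
Proof.
move=> xy uv; apply: (vletrans (y := x + v)); first exact: vle_add.
by rewrite [x + v]addrC [y + v]addrC; exact: vle_add.
Qed.

Lemma vaddr_ge0 x y : 0 <=v x -> 0 <=v y -> 0 <=v x + y.
Proof. by move=> x0 y0; have := vleD x0 y0; rewrite addr0. Qed.

Lemma vle_oppE x y : (- x <=v - y) = (y <=v x).
Proof. by rewrite vle_subE opprK addrC -vle_subE. Qed.

Lemma vscale_le a x y : 0 <= a -> x <=v y -> a *: x <=v a *: y.
Proof.
by move=> a0; rewrite (vle_subE x) (vle_subE (a *: x)) -scalerBr; exact: vle_scale.
Qed.

Lemma modulus_ge x : x <=v modulus x. Proof. exact: vle_joinl. Qed.

Lemma modulus_geN x : - x <=v modulus x. Proof. exact: vle_joinr. Qed.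

Lemma modulus_le x y : x <=v y -> - x <=v y -> modulus x <=v y.
Proof. exact: vjoin_le. Qed.

Lemma modulus_ge0 x : 0 <=v modulus x.
Proof.
have := vleD (modulus_ge x) (modulus_geN x); rewrite subrr -mulr2n -scaler_nat.
move/(vscale_le (a := 2^-1)); rewrite scaler0 scalerA mulVf ?pnatr_eq0//.
by rewrite scale1r; apply.
Qed.

Lemma ge0_modulus x : 0 <=v x -> modulus x = x.
Proof.
move=> x0; apply: vle_anti; rewrite modulus_ge andbT modulus_le ?vle_refl//.
apply: (vletrans _ x0); by rewrite -oppr0 vle_oppE.
Qed.

Lemma modulusN x : modulus (- x) = modulus x.
Proof.
suff H y : modulus (- y) <=v modulus y.
  by apply: vle_anti; rewrite H -{1}(opprK x) H.
by apply: modulus_le; rewrite ?opprK ?modulus_ge ?modulus_geN.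
Qed.

Lemma modulus0 : modulus 0 = 0 :> E.
Proof. by apply: ge0_modulus; exact: vle_refl. Qed.

Lemma modulusD x y : modulus (x + y) <=v modulus x + modulus y.
Proof.
by apply: modulus_le; rewrite ?opprD; apply: vleD; rewrite ?modulus_ge ?modulus_geN.
Qed.

Lemma modulusZ_le a x : modulus (a *: x) <=v `|a| *: modulus x.
Proof.
wlog a0 : a x / 0 <= a.
  move=> H; have [/H//|/ltW a0] := leP 0 a.
  by have := H (- a) (- x); rewrite scalerN scaleNr opprK normrN modulusN oppr_ge0; apply.
rewrite ger0_norm//; apply: modulus_le; rewrite -?scalerN; apply: vscale_le => //.
  exact: modulus_ge.
exact: modulus_geN.
Qed.

Lemma norm_le_of_vle x y : modulus x <=v y -> `|x| <= `|y|.
Proof.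
move=> xy; exact: norm_vle (vletrans xy (modulus_ge y)).
Qed.

Lemma norm_le_ge0 x y : 0 <=v x -> x <=v y -> `|x| <= `|y|.
Proof. by move=> x0 xy; apply: norm_le_of_vle; rewrite ge0_modulus. Qed.

Lemma norm_modulus x : `|modulus x| = `|x|.
Proof.
have mm := ge0_modulus (modulus_ge0 x).
by apply/eqP; rewrite eq_le; apply/andP; split; apply: norm_vle;
  rewrite -!/(modulus _) mm vle_refl.
Qed.

Lemma modulus_eq0 x : modulus x = 0 -> x = 0.
Proof. by move=> x0; apply/eqP; rewrite -normr_eq0 -norm_modulus x0 normr0. Qed.

Definition pospart x : E := vjoin x 0.

Lemma pospart_ge x : x <=v pospart x. Proof. exact: vle_joinl. Qed.

Lemma pospart_ge0 x : 0 <=v pospart x. Proof. exact: vle_joinr. Qed.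

Lemma pospart_le x y : x <=v y -> 0 <=v y -> pospart x <=v y.
Proof. exact: vjoin_le. Qed.

Lemma le_pospart x y : x <=v y -> pospart x <=v pospart y.
Proof.
move=> xy; apply: pospart_le; last exact: pospart_ge0.
exact: vletrans xy (pospart_ge y).
Qed.

Lemma pospartD x y : pospart (x + y) <=v pospart x + pospart y.
Proof.
apply: pospart_le; first by apply: vleD; exact: pospart_ge.
by apply: vaddr_ge0; exact: pospart_ge0.
Qed.

Lemma pospartZ_le a x : 0 <= a -> pospart (a *: x) <=v a *: pospart x.
Proof.
move=> a0; apply: pospart_le; last exact: (vle_scale _ _ a0 (pospart_ge0 x)).
exact: (vscale_le a0 (pospart_ge x)).
Qed.

Lemma pospart_le_modulus x : pospart x <=v modulus x.
Proof. by apply: pospart_le; [exact: modulus_ge|exact: modulus_ge0]. Qed.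

Lemma vge0_of_norm_pospart x : `|pospart (- x)| = 0 -> 0 <=v x.
Proof.
move=> /normr0_eq0 x0; have := pospart_ge (- x).
by rewrite x0 vle_subE sub0r opprK.
Qed.

(** The negative part of [x] is dominated by the modulus of [u i - x], whose norm becomes
    arbitrarily small. *)
Lemma vge0_lim (I : Type) (F : set_system I) {FF : ProperFilter F} (u : I -> E) x :
  (forall i, 0 <=v u i) -> u @ F --> x -> 0 <=v x.
Proof.
move=> u0 ux; apply: vge0_of_norm_pospart; apply/eqP; rewrite eq_le normr_ge0 andbT.
apply/ler_addgt0Pr => e e0; rewrite add0r.
have /filter_ex[i xi] : \forall i \near F, `|x - u i| < e.
  by move/cvgrPdist_lt : ux; exact.
apply: le_trans (ltW xi); rewrite distrC -(norm_modulus (u i - x)); apply: norm_le_ge0.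
  exact: pospart_ge0.
apply: pospart_le; last exact: modulus_ge0.
apply: (vletrans _ (modulus_ge _)).
by rewrite vle_subE opprK subrK.
Qed.

Lemma pospart0 : pospart 0 = 0 :> E.
Proof.
apply: vle_anti; rewrite pospart_ge0 andbT.
by apply: pospart_le; exact: vle_refl.
Qed.

End BanachLattice.

(** * Positive operators *)

Section LinearPredicate.
Context {R : realType} {U V : normedModType R}.
Implicit Types f : U -> V.

Definition bounded_by (M : R) f := forall x, `|f x| <= M * `|x|.

(** Operators are kept as plain functions with a linearity hypothesis, because inverses and
    pointwise limits are obtained only as functions; bundling on demand opens the theory of linear
    maps to them. *)
Lemma lin_bundle f : linear f -> {g : {linear U -> V} | g = f :> (U -> V)}.
Proof.
move=> lf; pose mf := GRing.isLinear.Build R U V *:%R f lf.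
pose g : {linear U -> V} := HB.pack f mf.
by exists g.
Qed.

Variables (f : U -> V) (lf : linear f).

Lemma lin0 : f 0 = 0.
Proof. by have [g <-] := lin_bundle lf; rewrite linear0. Qed.

Lemma linD x y : f (x + y) = f x + f y.
Proof. by have [g <-] := lin_bundle lf; rewrite linearD. Qed.

Lemma linB x y : f (x - y) = f x - f y.
Proof. by have [g <-] := lin_bundle lf; rewrite linearB. Qed.

Lemma linN x : f (- x) = - f x.
Proof. by have [g <-] := lin_bundle lf; rewrite linearN. Qed.

Lemma linZ a x : f (a *: x) = a *: f x.
Proof. by have [g <-] := lin_bundle lf; rewrite linearZ. Qed.

Lemma bounded_by_cvg M (I : Type) (F : set_system I) {FF : Filter F} (u : I -> U) l :
  bounded_by M f -> u @ F --> l -> (fun i => f (u i)) @ F --> f l.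
Proof.
move=> fM ul; apply/cvgrPdist_lt => e e0.
have M0 : 0 < `|M| + 1 by rewrite ltr_wpDl.
near=> i.
rewrite -linB; apply: (le_lt_trans (fM _)).
apply: (@le_lt_trans _ _ ((`|M| + 1) * `|l - u i|)).
  by rewrite ler_wpM2r// (le_trans (ler_norm _))// lerDl.
rewrite mulrC -ltr_pdivlMr//; near: i.
by move/cvgrPdist_lt : ul; apply; rewrite divr_gt0.
Unshelve. all: by end_near. Qed.

End LinearPredicate.

Section PositiveOperators.
Context {R : realType} {E : banachLatticeType R}.
Implicit Types (f g : E -> E) (x y z : E).

(** The bound is strictly positive so that later estimates can divide by it. *)
Definition pos_op f := [/\ linear f, op_ge0 f & exists2 M : R, 0 < M & bounded_by M f].

Lemma op_ge0_le f x y : linear f -> op_ge0 f -> x <=v y -> f x <=v f y.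
Proof. by move=> lf f0; rewrite vle_subE (vle_subE (f x)) -linB//; exact: f0. Qed.

Lemma modulus_op f x : linear f -> op_ge0 f -> modulus (f x) <=v f (modulus x).
Proof.
move=> lf f0; apply: modulus_le; rewrite -?linN//; apply: op_ge0_le => //.
  exact: modulus_ge.
exact: modulus_geN.
Qed.

Lemma pospart_op f x : linear f -> op_ge0 f -> pospart (f x) <=v f (pospart x).
Proof.
move=> lf f0; apply: pospart_le; last by apply: f0; exact: pospart_ge0.
by apply: op_ge0_le => //; exact: pospart_ge.
Qed.

Lemma norm_op_modulus f x : linear f -> op_ge0 f -> `|f x| <= `|f (modulus x)|.
Proof.
move=> lf f0; rewrite -(norm_modulus (f x)); apply: norm_le_ge0.
  exact: modulus_ge0.
exact: modulus_op.
Qed.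

Lemma pos_op_id : pos_op (@id E).
Proof. by split=> //; exists 1 => // x; rewrite mul1r. Qed.

Lemma pos_op_comp f g : pos_op f -> pos_op g -> pos_op (f \o g).
Proof.
move=> [lf f0 [M M0 fM]] [lg g0 [N N0 gN]]; split.
- by move=> a x y /=; rewrite lg lf.
- by move=> x /g0 /f0.
- exists (M * N); first exact: mulr_gt0.
  move=> x /=; apply: (le_trans (fM _)); rewrite -mulrA.
  by apply: ler_wpM2l; [exact: ltW|exact: gN].
Qed.

Lemma pos_op_add f g : pos_op f -> pos_op g -> pos_op (fun x => f x + g x).
Proof.
move=> [lf f0 [M M0 fM]] [lg g0 [N N0 gN]]; split.
- by move=> a x y; rewrite lg lf scalerDr addrACA.
- by move=> x x0; apply: vaddr_ge0; [exact: f0|exact: g0].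
- exists (M + N); first exact: addr_gt0.
  by move=> x; rewrite mulrDl (le_trans (ler_normD _ _))// lerD.
Qed.

Lemma pos_op_scale (a : R) f : 0 <= a -> pos_op f -> pos_op (fun x => a *: f x).
Proof.
move=> a0 [lf f0 [M M0 fM]]; split.
- by move=> b x y; rewrite lf scalerDr !scalerA mulrC.
- by move=> x x0; apply: vle_scale => //; exact: f0.
- exists ((a + 1) * M); first by rewrite mulr_gt0// ltr_wpDl.
  move=> x; rewrite normrZ ger0_norm// -mulrA.
  by apply: ler_pM => //; rewrite lerDl.
Qed.

Lemma pos_op_iter f n : pos_op f -> pos_op (iter n f).
Proof.
move=> fp; elim: n => [|n IH]; first exact: pos_op_id.
exact: (pos_op_comp fp IH).
Qed.

Lemma pos_op_cvg f (I : Type) (F : set_system I) {FF : Filter F} (u : I -> E) l :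
  pos_op f -> u @ F --> l -> (fun i => f (u i)) @ F --> f l.
Proof. case=> lf _ [M _ fM]; exact: (bounded_by_cvg lf fM). Qed.

Lemma iter_op_le f g n x : pos_op f -> pos_op g -> op_le f g -> 0 <=v x ->
  iter n f x <=v iter n g x.
Proof.
move=> fp gp fg x0; elim: n => [|n IH]; first exact: vle_refl.
have [_ h _] := pos_op_iter n fp.
rewrite !iterS; apply: (@vletrans _ _ (g (iter n f x))).
  by rewrite vle_subE; apply: fg; exact: h.
by case: gp => lg g0 _; exact: op_ge0_le.
Qed.

Lemma pos_op_of_continuous (f : {linear E -> E}) :
  continuous f -> op_ge0 f -> pos_op f.
Proof.
move=> cf f0; split; [exact: linearP|by []|].
have /continuous_linear_bounded/linear_boundedP := cf 0.
move=> [M [_ fM]]; exists (`|M| + 1); first by rewrite ltr_wpDl.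
by apply: fM; rewrite (le_lt_trans (ler_norm _))// ltrDl.
Qed.

(* [J] below is the closure of the ideal generated by [D]. *)
Section DenseIdeal.
Variables (S : E -> E) (D : set E) (y : E).
Hypotheses (S_pos : pos_op S) (S_irr : irreducible_op S).
Hypothesis D_add : forall u v, D u -> D v -> D (u + v).
Hypothesis D_scale : forall (a : R) u, 0 <= a -> D u -> D (a *: u).
Hypothesis D_S : forall u, D u -> D (S u).
Hypotheses (Dy : D y) (y_ge0 : 0 <=v y) (y_neq0 : y != 0).

Let J : set E := [set x | forall e : R, 0 < e ->
  exists2 z, D z & `|pospart (modulus x - z)| < e].

Let J_ideal : lattice_ideal J.
Proof.
split.
- move=> e e0; exists (0 *: y); first exact: D_scale.
  by rewrite scale0r subr0 modulus0 pospart0 normr0.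
- move=> a x x' Jx Jx' e e0.
  have a1 : 0 < `|a| + 1 by rewrite ltr_wpDl.
  have [z Dz xz] := Jx (e / 2 / (`|a| + 1)) ltac:(by rewrite !divr_gt0).
  have [z' Dz' xz'] := Jx' (e / 2) ltac:(by rewrite divr_gt0).
  exists (`|a| *: z + z'); first by apply: D_add => //; exact: D_scale.
  apply: (@le_lt_trans _ _
      `| `|a| *: pospart (modulus x - z) + pospart (modulus x' - z')|).
    apply: norm_le_ge0; first exact: pospart_ge0.
    apply: (@vletrans _ _ (pospart (`|a| *: (modulus x - z) + (modulus x' - z')))).
      apply: le_pospart; rewrite scalerBr addrACA -opprD.
      apply: vleD; last exact: vle_refl.
      apply: vletrans (modulusD _ _) _; apply: vleD; last exact: vle_refl.
      exact: modulusZ_le.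
    apply: vletrans (pospartD _ _) _; apply: vleD; last exact: vle_refl.
    exact: pospartZ_le.
  apply: (le_lt_trans (ler_normD _ _)); rewrite (splitr e); apply: ltrD => //.
  rewrite normrZ normr_id.
  apply: (@le_lt_trans _ _ ((`|a| + 1) * `|pospart (modulus x - z)|)).
    by rewrite ler_wpM2r// lerDl.
  by rewrite mulrC -ltr_pdivlMr.
- move=> x x' Jx' xx' e e0; have [z Dz xz] := Jx' e e0; exists z => //.
  apply: le_lt_trans xz; apply: norm_le_ge0; first exact: pospart_ge0.
  by apply: le_pospart; apply: vleD => //; exact: vle_refl.
Qed.

Let J_closed : closed J.
Proof.
move=> x clJ e e0.
have e2 : 0 < e / 2 by rewrite divr_gt0.
have /clJ [x' [Jx' xx']] := nbhsx_ballx x _ e2.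
have [z Dz xz] := Jx' _ e2; exists z => //.
apply: (@le_lt_trans _ _ `|modulus (x - x') + pospart (modulus x' - z)|).
  apply: norm_le_ge0; first exact: pospart_ge0.
  have xz0 : 0 <=v modulus (x - x') + pospart (modulus x' - z).
    by apply: vaddr_ge0; [exact: modulus_ge0|exact: pospart_ge0].
  apply: pospart_le => //.
  apply: (@vletrans _ _ (modulus (x - x') + (modulus x' - z))).
    rewrite addrA; apply: vleD; last exact: vle_refl.
    by rewrite -{1}(subrK x' x); exact: modulusD.
  by apply: vleD; [exact: vle_refl|exact: pospart_ge].
apply: (le_lt_trans (ler_normD _ _)); rewrite (splitr e); apply: ltrD => //.
by rewrite norm_modulus; move: xx'; rewrite -ball_normE.
Qed.

Let J_inv : S @` J `<=` J.
Proof.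
move=> _ [x Jx <-] e e0.
case: S_pos => lS S0 [M M0 SM].
have [z Dz xz] := Jx (e / M) ltac:(by rewrite divr_gt0).
exists (S z); first exact: D_S.
apply: (@le_lt_trans _ _ `|S (pospart (modulus x - z))|).
  apply: norm_le_ge0; first exact: pospart_ge0.
  apply: (@vletrans _ _ (pospart (S (modulus x - z)))); last exact: pospart_op.
  apply: le_pospart; rewrite linB//; apply: vleD; last exact: vle_refl.
  exact: modulus_op.
by apply: (le_lt_trans (SM _)); rewrite mulrC -ltr_pdivlMr.
Qed.

(** [J] is a closed [S]-invariant ideal containing [y], so irreducibility forces it to be all of
    [E]. A small positive part of [modulus x - z] means that [modulus x] lies below [z] up to a
    small error. *)
Lemma irreducible_dense x (e : R) : 0 < e ->
  exists2 z, D z & `|pospart (modulus x - z)| < e.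
Proof.
move=> e0; case: S_irr => _ _ /(_ J J_ideal J_closed J_inv)[J0|JT].
  have : J y.
    move=> d d0; exists y => //; by rewrite ge0_modulus// subrr pospart0 normr0.
  by rewrite J0 => /eqP; rewrite (negbTE y_neq0).
have Jx : J x by rewrite JT.
exact: Jx.
Qed.

End DenseIdeal.

End PositiveOperators.

(** * Resolvents and growth rate *)

Section Neumann.
Context {R : realType} {V : completeNormedModType R}.
Variables (f : V -> V) (C q : R).
Hypotheses (lf : linear f) (C0 : 0 <= C) (q0 : 0 <= q) (q1 : q < 1).
Hypothesis f_iter : forall n, bounded_by (C * q ^+ n) (iter n f).

Let s (x : V) := series (fun n => iter n f x).

Let ns_le x n : `|iter n f x| <= geometric (C * `|x|) q n.
Proof. by rewrite /geometric/= mulrAC; exact: f_iter. Qed.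

Let nq : `|q| < 1. Proof. by rewrite ger0_norm. Qed.

Let ns_cvg x : cvgn [normed series (fun n => iter n f x)].
Proof.
apply: (series_le_cvg _ _ (ns_le x)) => //; last exact: is_cvg_geometric_series.
by move=> n; rewrite /geometric/= mulr_ge0 ?exprn_ge0 ?mulr_ge0.
Qed.

Let s_cvg x : s x @ \oo --> limn (s x).
Proof. exact/normed_cvg/ns_cvg. Qed.

Let g x := limn (s x).

Let iter_lin n : linear (iter n f).
Proof. by elim: n => // n IH a x y; rewrite !iterS IH lf. Qed.

Let s_lin n : linear (fun x => s x n).
Proof.
move=> a x y; rewrite /s /series/= scaler_sumr -big_split/=.
by apply: eq_bigr => i _; rewrite iter_lin.
Qed.

Let g_lin : linear g.
Proof.
move=> a x y; apply/cvg_lim; first exact: norm_hausdorff.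
rewrite (_ : s _ = (fun n => a *: s x n + s y n)); last first.
  by apply/funext => n; exact: s_lin.
by apply: cvgD; [apply: cvgZl_tmp|]; exact: s_cvg.
Qed.

Let g_bnd : bounded_by (C / (1 - q)) g.
Proof.
move=> x; apply: (le_trans (lim_series_norm (@ns_cvg x))).
have gc : series (geometric (C * `|x|) q) @ \oo --> C / (1 - q) * `|x|.
  by rewrite mulrAC; exact: cvg_geometric_series.
rewrite -(cvg_lim (@norm_hausdorff _ _) gc).
apply: lim_series_le; [exact: ns_cvg|exact: is_cvg_geometric_series|].
exact: ns_le.
Qed.

Let s_sub x n : s (x - f x) n = x - iter n f x.
Proof.
elim: n => [|n IH]; first by rewrite /s /series/= big_geq//= subrr.
rewrite /s seriesSr -/(s _ n) IH (linB (iter_lin n)) -iterSr.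
by rewrite addrA subrK.
Qed.

Let gK x : g (x - f x) = x.
Proof.
apply/cvg_lim; first exact: norm_hausdorff.
rewrite (_ : s _ = (fun n => x - iter n f x)); last first.
  by apply/funext => n; exact: s_sub.
rewrite -[X in _ --> X]subr0; apply: cvgB; first exact: cvg_cst.
apply/norm_cvg0P.
apply: (@squeeze_cvgr _ _ _ _ (fun=> 0) (geometric (C * `|x|) q)).
- by near=> n; rewrite normr_ge0; exact: ns_le.
- exact: cvg_cst.
- exact: cvg_geometric.
Unshelve. all: by end_near. Qed.

(** The bound is on the iterates, so it is the growth rate and not the norm of [f] that has to be
    below 1. The partial sums at [x - f x] telescope, which makes the sum [g] a left inverse;
    continuity of [f] gives [f (g x) = g (f x)], hence a right inverse. *)
Lemma neumann : exists g : V -> V,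
  [/\ linear g, bounded_by (C / (1 - q)) g,
      cancel (fun x => x - f x) g, cancel g (fun x => x - f x) &
      forall x, series (fun n => iter n f x) @ \oo --> g x].
Proof.
exists g; split=> //.
move=> x; rewrite -[RHS]gK linB//; congr (_ - _).
have := bounded_by_cvg lf (f_iter 1) (@s_cvg x).
move=> h; apply/esym/cvg_lim; first exact: norm_hausdorff.
rewrite (_ : s (f x) = (fun n => f (s x n))); first exact: h.
apply/funext => n; rewrite /s /series/=.
have [h' <-] := lin_bundle lf; rewrite linear_sum; apply: eq_bigr => i _.
by rewrite -iterSr.
Qed.

End Neumann.

Section Growth.
Context {R : realType} {E : banachLatticeType R}.
Implicit Types (f : E -> E) (x y : E) (l : R).

Definition growth f : set R := [set l | 0 < l /\
  exists2 C : R, 0 <= C & forall n, bounded_by (C * l ^+ n) (iter n f)].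

Definition growth_rate f : R := inf (growth f).

Lemma growth_has_inf f : pos_op f -> has_inf (growth f).
Proof.
move=> [_ _ [M M0 fM]]; split; last by exists 0 => l [/ltW].
exists M; split => //; exists 1 => // n x; rewrite mul1r.
elim: n x => [|n IH] x; first by rewrite mul1r.
rewrite iterS exprS -mulrA; apply: (le_trans (fM _)).
by apply: ler_wpM2l => //; exact: ltW.
Qed.

Lemma growth_rate_le f l : pos_op f -> growth f l -> growth_rate f <= l.
Proof. by move=> fp fl; apply: ge_inf => //; case: (growth_has_inf fp). Qed.

Lemma growth_rate_ge0 f : pos_op f -> 0 <= growth_rate f.
Proof.
move=> fp; apply: lb_le_inf; first by case: (growth_has_inf fp).
by move=> l [/ltW].
Qed.

Lemma growth_rate_lt f l : pos_op f -> growth_rate f < l -> growth f l.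
Proof.
move=> fp fl.
have lf0 : 0 < l - growth_rate f by rewrite subr_gt0.
have [m [m0 [C C0 fC]]] := inf_adherent lf0 (growth_has_inf fp).
rewrite addrC subrK => ml; split; first exact: lt_trans ml.
exists C => // n x; apply: (le_trans (fC n x)).
apply: ler_wpM2r => //; apply: ler_wpM2l => //.
by rewrite lerXn2r// ?nnegrE ltW// (lt_trans m0).
Qed.

Lemma growth_rate_mono f g : pos_op f -> pos_op g -> op_le f g ->
  growth_rate f <= growth_rate g.
Proof.
move=> fp gp fg; apply: lb_le_inf; first by case: (growth_has_inf gp).
move=> l [l0 [C C0 gC]]; apply: growth_rate_le => //; split => //.
exists C => // n x.
have [lfn fn0 _] := pos_op_iter n fp.
apply: (le_trans (norm_op_modulus x lfn fn0)).
have := gC n (modulus x); rewrite norm_modulus; apply: le_trans.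
apply: norm_le_ge0; first by apply: fn0; exact: modulus_ge0.
by apply: iter_op_le => //; exact: modulus_ge0.
Qed.

Lemma iter_scale f (a : R) n x : linear f ->
  iter n (fun y => a *: f y) x = a ^+ n *: iter n f x.
Proof.
move=> lf; elim: n => [|n IH]; first by rewrite scale1r.
by rewrite !iterS IH (linZ lf) scalerA -exprS.
Qed.

Lemma pos_neumann f C q : pos_op f -> 0 <= C -> 0 <= q -> q < 1 ->
  (forall n, bounded_by (C * q ^+ n) (iter n f)) ->
  exists g, [/\ pos_op g, cancel (fun x => x - f x) g &
                cancel g (fun x => x - f x)].
Proof.
move=> fp C0 q0 q1 fC; have [lf f0 _] := fp.
have [g [lg gC gK Kg gs]] := neumann lf C0 q0 q1 fC.
exists g; split => //; split => //.
- move=> x x0; apply: (vge0_lim _ (@gs x)) => n; rewrite /series/=.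
  elim/big_ind : _ => [|u v u0 v0|i _]; [exact: vle_refl|exact: vaddr_ge0|].
  by have [_ h _] := pos_op_iter i fp; exact: h.
(* The added 1 keeps the bound strictly positive when [C = 0]. *)
- exists (C / (1 - q) + 1); last first.
    by move=> x; rewrite (le_trans (gC x))// ler_wpM2r// lerDl.
  by rewrite ltr_wpDl// divr_ge0// subr_ge0 ltW.
Qed.

(** Neumann series of [f / l]: for [m] strictly between the growth rate and [l], its iterates decay
    like [(m / l)^n]. *)
Lemma resolvent_pos f l : pos_op f -> growth_rate f < l ->
  exists Q, [/\ pos_op Q, cancel (fun x => l *: x - f x) Q &
                cancel Q (fun x => l *: x - f x)].
Proof.
move=> fp fl; have [lf f0 _] := fp.
have l0 : 0 < l by apply: le_lt_trans fl; exact: growth_rate_ge0.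
have [m [fm ml]] : exists m, growth_rate f < m /\ m < l.
  by exists ((growth_rate f + l) / 2); rewrite !midf_lt.
have [m0 [C C0 fC]] := growth_rate_lt fp fm.
have l'0 : 0 <= l^-1 by rewrite invr_ge0 ltW.
have [|||g [gp gK Kg]] := pos_neumann (pos_op_scale l'0 fp) C0 (q := m / l).
- by rewrite divr_ge0 ?ltW.
- by rewrite ltr_pdivrMr// mul1r.
- move=> n x; rewrite iter_scale// normrZ ger0_norm ?exprn_ge0//.
  rewrite (_ : _ * `|x| = l^-1 ^+ n * (C * m ^+ n * `|x|)); last first.
    by rewrite exprMn; ring.
  by apply: ler_wpM2l; [exact: exprn_ge0|exact: fC].
have [lg _ _] := gp.
have e x : l *: x - f x = l *: (x - l^-1 *: f x).
  by rewrite scalerBr scalerA divff ?scale1r// gt_eqF.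
exists (fun x => l^-1 *: g x); split.
- exact: pos_op_scale.
- by move=> x; rewrite e linZ// gK scalerA mulVf ?scale1r// gt_eqF.
- move=> x; rewrite -(linZ lg) e Kg scalerA divff ?scale1r// gt_eqF//.
Qed.

(* A positive inverse of l - f can be continued to the left of l, and a positive
   left inverse W of m - f satisfies f^n <= m^(n+1) W. *)
Lemma growth_of_resolvent f l Q M d : pos_op f -> pos_op Q ->
  cancel (fun x => l *: x - f x) Q -> 0 < M -> bounded_by M Q ->
  0 < d -> d < l -> d * M < 1 -> growth f (l - d).
Proof.
move=> fp Qp QK M0 QM d0 dl dM; have [lf f0 _] := fp; have [lQ _ _] := Qp.
have [|||g [gp gK _]] := pos_neumann (pos_op_scale (ltW d0) Qp) ler01 (q := d * M).
- by rewrite mulr_ge0 ?ltW.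
- exact: dM.
- move=> n x; rewrite mul1r; elim: n => [|n IH]; first by rewrite mul1r.
  rewrite iterS normrZ gtr0_norm// exprS -!mulrA.
  apply: ler_wpM2l; first exact: ltW.
  by apply: (le_trans (QM _)); apply: ler_wpM2l; [exact: ltW|exact: IH].
have Wp := pos_op_comp gp Qp; set W := g \o Q in Wp.
have [lW W0 [N N0 WN]] := Wp; have [lg _ _] := gp.
set m := l - d; have m0 : 0 < m by rewrite subr_gt0.
(* [W] is a left inverse of [m - f], since [Q (m y - f y) = y - d Q y] and [g] inverts [1 - d Q]. *)
have WK y : m *: W y = y + W (f y).
  apply/eqP; rewrite -subr_eq -(linZ lW) -(linB lW) /W/=.
  suff -> : Q (m *: y - f y) = y - d *: Q y by rewrite gK.
  by rewrite scalerBl addrAC (linB lQ) (linZ lQ) QK.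
(* In [m W y = y + W (f y)] both summands are positive, so each of them is below [m W y]. *)
have key n y : 0 <=v y -> iter n f y <=v m ^+ n.+1 *: W y.
  elim: n y => [|n IH] y y0.
    by rewrite expr1 WK vle_subE addrC addKr; apply: W0; exact: f0.
  rewrite iterSr; apply: (vletrans (IH _ (f0 _ y0))).
  rewrite [in X in _ <=v X]exprSr -scalerA; apply: vscale_le.
    by rewrite exprn_ge0// ltW.
  by rewrite WK vle_subE addrK.
split => //; exists (m * N); first by rewrite mulr_ge0 ?ltW.
move=> n x; have [lfn fn0 _] := pos_op_iter n fp.
apply: (le_trans (norm_op_modulus x lfn fn0)).
apply: (le_trans (norm_le_ge0 (fn0 _ (modulus_ge0 x)) (key n _ (modulus_ge0 x)))).
rewrite normrZ gtr0_norm ?exprn_gt0//.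
rewrite (_ : m * N * m ^+ n * `|x| = m ^+ n.+1 * (N * `|x|)); last by rewrite exprS; ring.
apply: ler_wpM2l; first by rewrite exprn_ge0// ltW.
by have := WN (modulus x); rewrite norm_modulus.
Qed.

End Growth.

(** * Approximate eigenprojections at the growth rate *)

Section ApproximateEigenvectors.
Context {R : realType} {E : banachLatticeType R}.
Implicit Types (f : E -> E) (x y : E) (l : R).

(** The operator norm is a supremum over positive vectors only, because the modulus of [f x] is
    below [f (modulus x)]; almost norming vectors can therefore be chosen positive. *)
Lemma pos_op_norm f : pos_op f -> exists c : R,
  [/\ 0 <= c, bounded_by c f & forall e : R, 0 < e ->
      exists y, [/\ 0 <=v y, `|y| <= 1 & c - e < `|f y|]].
Proof.
move=> [lf f0 [M M0 fM]].
pose A := [set `|f y| | y in [set y : E | 0 <=v y /\ `|y| <= 1]].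
have A0 : A 0.
  exists 0; rewrite ?(lin0 lf) ?normr0//.
  by split; [exact: vle_refl|rewrite normr0].
have sA : has_sup A.
  split; first by exists 0.
  exists M => _ [y [_ y1] <-]; apply: (le_trans (fM y)).
  by rewrite -[leRHS]mulr1 ler_wpM2l// ltW.
exists (sup A); split; first exact: sup_upper_bound.
  move=> x; have [->|x0] := eqVneq x 0; first by rewrite (lin0 lf) normr0 mulr0.
  apply: (le_trans (norm_op_modulus x lf f0)).
  have nx : 0 < `|x| by rewrite normr_gt0.
  rewrite -ler_pdivrMr// mulrC -[X in X * _]gtr0_norm ?invr_gt0// -normrZ -(linZ lf).
  apply: sup_upper_bound => //; eexists; last reflexivity; split.
    by apply: vle_scale; [rewrite invr_ge0|exact: modulus_ge0].
  by rewrite normrZ norm_modulus gtr0_norm ?invr_gt0// mulVf// gt_eqF.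
move=> e e0; have [_ [y [y0 y1] <-] yc] := sup_adherent e0 sA.
by exists y.
Qed.

(** With [Q] the inverse of [r + d - f] and [c] its norm, take [P = Q / c]. Then
    [(f - r) P = d P - 1 / c] has norm at most [d + 1 / c], and [c] is large because the resolvent
    cannot be continued past [r]. *)
Lemma approximate_eigenprojection f (e : R) : pos_op f -> 0 < growth_rate f -> 0 < e ->
  exists P, [/\ pos_op P, bounded_by 1 P, forall x, P (f x) = f (P x),
    bounded_by e (fun x => f (P x) - growth_rate f *: P x) &
    exists y, [/\ 0 <=v y, `|y| <= 1 & 2^-1 < `|P y|]].
Proof.
set r := growth_rate f => fp r0 e0.
(* [d < r] keeps [2 d] below [r + d], and [3 d] bounds [d + 1 / c] once [1 / c <= 2 d] is known. *)
have [d [d0 dr de]] : exists d : R, [/\ 0 < d, d < r & 3 * d <= e].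
  exists (Num.min (r / 2) (e / 3)); split.
  - by rewrite lt_min !divr_gt0.
  - by rewrite gt_min ltr_pdivrMr// mulr_natr mulr2n ltrDl r0.
  - by rewrite mulrC -ler_pdivlMr// ge_min lexx orbT.
have [|Q [Qp QK KQ]] := resolvent_pos fp (l := r + d); first by rewrite ltrDl.
have [lQ _ _] := Qp; have [lf _ _] := fp.
have [c [c0 Qc Qy]] := pos_op_norm Qp.
(* Otherwise some bound [M] of [Q] has [2 d M < 1], and [growth_of_resolvent] puts [r - d] into
   [growth f], below its infimum [r]. *)
have cd : 1 <= c * (2 * d).
  rewrite leNgt; apply/negP => cd.
  have [M [M0 cM Md]] : exists M : R, [/\ 0 < M, c <= M & 2 * d * M < 1].
    have d2 : 0 < 2 * d by rewrite mulr_gt0.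
    have cd' : c < (2 * d)^-1 by rewrite -[X in _ < X]mul1r ltr_pdivlMr.
    exists ((c + (2 * d)^-1) / 2); split.
    - by rewrite divr_gt0// ltr_wpDl// invr_gt0.
    - by rewrite ltW// midf_lt.
    - by rewrite mulrC -ltr_pdivlMr// div1r midf_lt.
  have QM : bounded_by M Q by move=> x; rewrite (le_trans (Qc x))// ler_wpM2r.
  have d2r : 2 * d < r + d by rewrite mulr2n mulrDl mul1r ltrD2r.
  have := growth_of_resolvent fp Qp QK M0 QM _ d2r Md.
  rewrite mulr_gt0// => /(_ isT) /(growth_rate_le fp).
  by rewrite -/r leNgt => /negP; apply; lra.
have {}c0 : 0 < c.
  by rewrite lt_neqAle c0 andbT eq_sym; apply/eqP => c00; rewrite c00 mul0r ler10 in cd.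
have c'0 : 0 < c^-1 by rewrite invr_gt0.
have fQ x : f (Q x) = (r + d) *: Q x - x.
  by rewrite -[X in _ = _ - X]KQ subKr.
have Qf x : Q (f x) = f (Q x).
  by rewrite fQ -[X in _ = _ - X]QK (linB lQ) (linZ lQ) subKr.
exists (fun x => c^-1 *: Q x); split.
- exact: pos_op_scale (ltW c'0) Qp.
- move=> x; rewrite normrZ gtr0_norm// mul1r mulrC ler_pdivrMr// mulrC; exact: Qc.
- by move=> x; rewrite Qf linZ.
- move=> x; rewrite (linZ lf) fQ scalerA [r * _]mulrC -scalerA -scalerBr.
  rewrite scalerDl addrAC [r *: _ + _]addrC addrK.
  rewrite normrZ gtr0_norm// mulrC ler_pdivrMr//.
  apply: (le_trans (ler_normB _ _)); rewrite normrZ gtr0_norm//.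
  have h1 : d * `|Q x| <= d * (c * `|x|) by rewrite ler_pM2l.
  have h2 : 3 * d * (c * `|x|) <= e * (c * `|x|) by rewrite ler_wpM2r// mulr_ge0// ltW.
  have h3 : 1 * `|x| <= c * (2 * d) * `|x| by rewrite ler_wpM2r.
  lra.
- have [|y [y0 y1 yc]] := Qy (c / 2); first by rewrite divr_gt0.
  exists y; split=> //; rewrite normrZ gtr0_norm// mulrC ltr_pdivlMr//.
  by apply: le_lt_trans yc; lra.
Qed.

End ApproximateEigenvectors.

(** * The eigenprojection of a power compact operator *)

Lemma ultra_fmap (I T : Type) (U : set_system I) (h : I -> T) :
  UltraFilter U -> UltraFilter (h @ U).
Proof.
move=> UU; split; first exact: fmap_proper_filter.
move=> G GG hG; apply/seteqP; split=> [A GA|A]; last exact: hG.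
have [//|nA] := in_ultra_setVsetC (h @^-1` A) UU.
have GnA : G (~` A) by exact: hG.
by have [x []] := filter_ex (filterI GA GnA).
Qed.

Section EigenProjection.
Context {R : realType} {E : banachLatticeType R}.
Implicit Types (f T : E -> E) (x y : E).

(** Ultrafilters replace the extraction of subsequences: the image of an ultrafilter in a compact
    set converges. A single ultrafilter then serves for all vectors at once. *)
Lemma compact_op_ultra_cvg f (M : R) (I : Type) (U : set_system I) (u : I -> E) :
  UltraFilter U -> linear f -> compact_op f -> (forall i, `|u i| <= M) ->
  exists l : E, (fun i => f (u i)) @ U --> l.
Proof.
move=> UU lf [C fC [cC _]] uM.
have M0 : 0 < `|M| + 1 by rewrite ltr_wpDl.
pose v i := (`|M| + 1)^-1 *: u i.
have vC i : C (f (v i)).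
  apply: fC; exists (v i) => //=.
  rewrite normrZ gtr0_norm ?invr_gt0// mulrC ler_pdivrMr// mul1r.
  by rewrite (le_trans (uM i))// (le_trans (ler_norm _))// lerDl.
rewrite compact_ultra in cC.
have [|p [_ vp]] := cC _ (ultra_fmap (fun i => f (v i)) UU).
  by apply: (@filterE _ U) => i; exact: vC.
exists ((`|M| + 1) *: p).
rewrite (_ : (fun i => _) = (fun i => (`|M| + 1) *: f (v i))); last first.
  by apply/funext => i; rewrite /v (linZ lf) scalerA divff ?gt_eqF// scale1r.
by apply: cvgZl_tmp.
Qed.

(** Passes from approximate eigenvectors of [f] to those of its power, the operator for which
    compactness is available. *)
Lemma iter_eigen_cvg0 f (r : R) k (I : Type) (F : set_system I) {FF : Filter F}
    (u : I -> E) : pos_op f ->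
  (fun i => f (u i) - r *: u i) @ F --> 0 ->
  (fun i => iter k f (u i) - r ^+ k *: u i) @ F --> 0.
Proof.
move=> fp u0; have [lf _ _] := fp; elim: k => [|k IH].
  rewrite (_ : (fun i => _) = cst 0); first exact: cvg_cst.
  by apply/funext => i /=; rewrite scale1r subrr.
rewrite (_ : (fun i => _) = (fun i => f (iter k f (u i) - r ^+ k *: u i) +
    r ^+ k *: (f (u i) - r *: u i))); last first.
  apply/funext => i; rewrite (linB lf) (linZ lf) scalerBr scalerA -exprSr.
  by rewrite addrA subrK.
rewrite -[X in _ --> X]addr0; apply: cvgD.
  by rewrite -[X in _ --> X](lin0 lf); exact: pos_op_cvg.
by rewrite -[X in _ --> X](scaler0 _ (r ^+ k)); apply: cvgZl_tmp.
Qed.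

Lemma free_ultrafilter : exists U : set_system nat, UltraFilter U /\ \oo `<=` U.
Proof. by apply: ultraFilterLemma. Qed.

Lemma norm_le_cvg0 (I : Type) (F : set_system I) {FF : Filter F} (e : I -> R)
    (u : I -> E) :
  (forall i, `|u i| <= e i) -> e @ F --> 0 -> u @ F --> 0.
Proof.
move=> ue e0; apply/norm_cvg0P; apply: (@squeeze_cvgr _ _ _ _ (fun=> 0) e) => //.
- by apply: filterE => i; rewrite normr_ge0 ue.
- exact: cvg_cst.
Qed.

Lemma bounded_by_vanishing (e : nat -> R) (g : nat -> E -> E) (u : nat -> E) M
    (F : set_system nat) {FF : Filter F} :
  \oo `<=` F -> e @ \oo --> 0 -> (forall n, bounded_by (e n) (g n)) ->
  (forall n, `|u n| <= M) -> (fun n => g n (u n)) @ F --> 0.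
Proof.
move=> oF e0 ge uM; apply: (@norm_le_cvg0 _ _ _ (fun n => `|e n| * `|M|)).
  move=> n; rewrite (le_trans (ge n (u n)))//.
  apply: (@le_trans _ _ (`|e n| * `|u n|)); first by rewrite ler_wpM2r// ler_norm.
  by rewrite ler_wpM2l// (le_trans (uM n))// ler_norm.
have h : (fun n => `|e n| * `|M|) @ \oo --> (0 : R).
  rewrite -[X in _ --> X](mul0r `|M|); apply: cvgMr_tmp.
  by rewrite -(@normr0 _ R); exact: cvg_norm.
by move=> A /h; exact: oF.
Qed.

(** One operator [P] stands for the eigenvectors of [f] and of its adjoint: its values are
    eigenvectors, and [P (f x) = r P x] plays the part of a positive eigenfunctional. *)
Lemma krein_rutman f k : pos_op f -> 0 < growth_rate f -> compact_op (iter k f) ->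
  exists P, [/\ pos_op P, forall x, f (P x) = growth_rate f *: P x,
    forall x, P (f x) = growth_rate f *: P x & exists x, P x != 0].
Proof.
set r := growth_rate f => fp r0 fk; have [lf f0 _] := fp.
have rk0 : 0 < r ^+ k by rewrite exprn_gt0.
have [lfk fk0 _] := pos_op_iter k fp.
have [U [UU oU]] := free_ultrafilter.
have /choice[P Pn] : forall n : nat, exists P, [/\ pos_op P, bounded_by 1 P,
    forall x, P (f x) = f (P x),
    bounded_by (harmonic n) (fun x => f (P x) - r *: P x) &
    exists y, [/\ 0 <=v y, `|y| <= 1 & 2^-1 < `|P y|]].
  by move=> n; apply: approximate_eigenprojection => //; rewrite /harmonic invr_gt0.
have Pp n : pos_op (P n) by case: (Pn n).
have lP n : linear (P n) by case: (Pp n).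
have P1 n : bounded_by 1 (P n) by case: (Pn n).
have eig (u : nat -> E) (M : R) : (forall n, `|u n| <= M) ->
    (fun n => iter k f (P n (u n)) - r ^+ k *: P n (u n)) @ U --> 0.
  move=> uM; apply: iter_eigen_cvg0 => //.
  apply: (@bounded_by_vanishing _ (fun n x => f (P n x) - r *: P n x) u M U _ oU
            cvg_harmonic) => // n.
  by case: (Pn n).
(* [P n x] is recovered from [f^k (P n x)], which converges by compactness, up to an error that
   [eig] sends to 0. *)
have Pcvg x : exists l : E, (fun n => P n x) @ U --> l.
  have [|l Pl] := @compact_op_ultra_cvg (iter k f) `|x| _ U (fun n => P n x) UU lfk fk.
    by move=> n; rewrite (le_trans (P1 n x))// mul1r.
  exists ((r ^+ k)^-1 *: (l - 0)).
  rewrite (_ : (fun n => _) = (fun n => (r ^+ k)^-1 *: (iter k f (P n x) -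
      (iter k f (P n x) - r ^+ k *: P n x)))); last first.
    by apply/funext => n; rewrite subKr scalerA mulVf ?gt_eqF// scale1r.
  apply: cvgZl_tmp; apply: cvgB => //.
  by apply: (@eig (fun=> x) `|x|).
have [p pP] := choice Pcvg.
have pcvg x y : (fun n => P n x) @ U --> y -> p x = y.
  by move=> xy; rewrite -(cvg_lim (@norm_hausdorff _ _) xy); apply/esym/cvg_lim.
have pp : pos_op p.
  split.
  - move=> a x y; apply: pcvg.
    rewrite (_ : (fun n => _) = (fun n => a *: P n x + P n y)); last first.
      by apply/funext => n; exact: lP.
    by apply: cvgD; [apply: cvgZl_tmp|]; exact: pP.
  - by move=> x x0; apply: (vge0_lim _ (@pP x)) => n; case: (Pp n) => _ h _; exact: h.
  - exists 1 => // x; rewrite mul1r.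
    have h : (fun n => `|P n x|) @ U --> `|p x| by apply: cvg_norm; exact: pP.
    rewrite -(cvg_lim (@norm_hausdorff _ _) h).
    apply: limr_le; first by apply/cvg_ex; exists `|p x|.
    by apply: filterE => n; rewrite /= (le_trans (P1 n x))// mul1r.
have fpE x : f (p x) = r *: p x.
  apply/eqP; rewrite -subr_eq0; apply/eqP.
  have h1 : (fun n => f (P n x) - r *: P n x) @ U --> f (p x) - r *: p x.
    apply: cvgB; first by apply: pos_op_cvg.
    by apply: cvgZl_tmp; exact: pP.
  have h2 : (fun n => f (P n x) - r *: P n x) @ U --> 0.
    apply: (@bounded_by_vanishing _ (fun n x => f (P n x) - r *: P n x)
      (fun=> x) `|x| U _ oU cvg_harmonic) => // n.
    by case: (Pn n).
  by rewrite -(cvg_lim (@norm_hausdorff _ _) h1); apply/cvg_lim.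
exists p; split => //.
  move=> x; rewrite -fpE; apply: pcvg.
  rewrite (_ : (fun n => _) = (fun n => f (P n x))); first exact: pos_op_cvg.
  by apply/funext => n; case: (Pn n).
(* The limit is nonzero at the limit [z] of [f^k (y n)]. If [p z = 0], then [P n (f^k (y n))] tends
   to 0; it equals [f^k (P n (y n))], which is close to [r^k P n (y n)], whose norm exceeds
   [r^k / 2]. *)
have /choice[y yP] : forall n, exists y, `|y| <= 1 /\ 2^-1 < `|P n y|.
  by move=> n; case: (Pn n) => _ _ _ _ [y [_ y1 Py]]; exists y.
have [|z yz] := @compact_op_ultra_cvg (iter k f) 1 _ U y UU lfk fk.
  by move=> n; case: (yP n).
exists z; apply/eqP => pz0.
have c1 : (fun n => P n (iter k f (y n) - z)) @ U --> 0.
  apply: (@norm_le_cvg0 _ _ _ (fun n => `|iter k f (y n) - z|)).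
    by move=> n; rewrite (le_trans (P1 n _))// mul1r.
  apply/norm_cvg0P; rewrite -[X in _ --> X](subrr z).
  by apply: cvgB => //; exact: cvg_cst.
have c2 : (fun n => P n (iter k f (y n))) @ U --> 0.
  rewrite (_ : (fun n => _) = (fun n => P n (iter k f (y n) - z) + P n z)); last first.
    by apply/funext => n; rewrite (linB (lP n)) subrK.
  rewrite -[X in _ --> X]addr0; apply: cvgD => //.
  by rewrite -[X in _ --> X]pz0; exact: pP.
have Pit n m x : P n (iter m f x) = iter m f (P n x).
  elim: m => //= m <-; by case: (Pn n).
have c3 : (fun n => P n (y n)) @ U --> 0.
  rewrite (_ : (fun n => _) = (fun n => (r ^+ k)^-1 *: (P n (iter k f (y n)) -
      (iter k f (P n (y n)) - r ^+ k *: P n (y n))))); last first.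
    by apply/funext => n; rewrite Pit subKr scalerA mulVf ?gt_eqF// scale1r.
  rewrite -[X in _ --> X](scaler0 _ (r ^+ k)^-1) -[X in _ *: X](subr0 0).
  apply: cvgZl_tmp; apply: cvgB => //.
  by apply: (@eig y 1) => n; case: (yP n).
have /filter_ex[n] : \forall n \near U, `|P n (y n)| < 2^-1.
  by move/cvgr0Pnorm_lt : c3; apply; rewrite invr_gt0.
by case: (yP n) => _ /lt_trans h /h; rewrite ltxx.
Qed.

End EigenProjection.

(** * Comparison of growth rates *)

Section Domination.
Context {R : realType} {E : banachLatticeType R}.
Implicit Types (S T : E -> E) (x y : E).

(** A closed ideal invariant under [T] is invariant under [S], because the modulus of [S y] is below
    [T (modulus y)]. *)
Lemma irreducible_le S T : pos_op S -> pos_op T -> op_le S T ->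
  irreducible_op S -> irreducible_op T.
Proof.
move=> [lS S0 _] [lT T0 _] ST [[x Sx] _ Sirr]; split => //.
- exists (modulus x); apply/eqP => Tx; move/eqP : Sx; apply.
  have Sm0 : S (modulus x) = 0.
    apply: vle_anti; rewrite (S0 _ (modulus_ge0 x)) andbT -Tx vle_subE.
    by apply: ST; exact: modulus_ge0.
  by apply/eqP; rewrite -normr_le0 (le_trans (norm_op_modulus x lS S0))// Sm0 normr0.
- move=> J [J0 Jlin Jsol] Jcl JT; apply: Sirr => //.
  move=> _ [y Jy <-].
  have Jm : J (modulus y).
    by apply: (Jsol _ y) => //; rewrite ge0_modulus ?modulus_ge0 ?vle_refl.
  apply: (Jsol _ (T (modulus y))); first by apply: JT; exists (modulus y).
  rewrite (ge0_modulus (T0 _ (modulus_ge0 y))).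
  apply: (vletrans (modulus_op y lS S0)).
  by rewrite vle_subE; apply: ST; exact: modulus_ge0.
Qed.

(** The vectors [y] with [P (modulus y) = 0] form a closed [S]-invariant ideal. It is not [E]
    because [P] is nonzero, so it is trivial and [P] is strictly positive. *)
Lemma null_ideal_trivial S P : irreducible_op S -> pos_op P -> linear S ->
  (exists x, P x != 0) ->
  (forall x, 0 <=v x -> P x = 0 -> P (S x) = 0) ->
  forall x, 0 <=v x -> P x = 0 -> x = 0.
Proof.
move=> [_ S0 Sirr] Pp lS [x0 Px0] PS x xge0 Px; have [lP P0 [M M0 PM]] := Pp.
have mono u v : 0 <=v u -> u <=v v -> P v = 0 -> P u = 0.
  move=> u0 uv Pv; apply: vle_anti; rewrite (P0 _ u0) andbT -Pv.
  exact: op_ge0_le.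
pose J : set E := [set y | P (modulus y) = 0].
have [|||J0|JT] := Sirr J.
- split.
  + by rewrite /J/= modulus0 (lin0 lP).
  + move=> a u v Ju Jv; rewrite /J/=.
    apply: (mono _ (`|a| *: modulus u + modulus v)); first exact: modulus_ge0.
      apply: (vletrans (modulusD _ _)); apply: vleD; last exact: vle_refl.
      exact: modulusZ_le.
    by rewrite lP Ju Jv scaler0 addr0.
  + move=> u v Jv uv; apply: (mono _ (modulus v)) => //; exact: modulus_ge0.
- move=> u clJ; apply/eqP; rewrite -normr_le0.
  apply/ler_addgt0Pr => e e0; rewrite add0r.
  have eM : 0 < e / M by rewrite divr_gt0.
  have [v [Jv uv]] := clJ _ (nbhsx_ballx u _ eM).
  apply: (@le_trans _ _ `|P (modulus (u - v) + modulus v)|).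
    apply: norm_le_ge0; first by apply: P0; exact: modulus_ge0.
    apply: op_ge0_le => //; rewrite -{1}(subrK v u); exact: modulusD.
  rewrite (linD lP) (Jv : P (modulus v) = 0) addr0 (le_trans (PM _))// norm_modulus.
  rewrite mulrC -ler_pdivlMr// ltW//.
  by move: uv; rewrite -ball_normE.
- move=> _ [u Ju <-]; rewrite /J/=.
  apply: (mono _ (S (modulus u))); first exact: modulus_ge0.
    exact: modulus_op.
  exact: PS _ (modulus_ge0 u) Ju.
- have : J x by rewrite /J/= ge0_modulus.
  by rewrite J0.
- have Jx0 : J x0 by rewrite JT.
  exfalso; move/eqP : Px0; apply; apply/eqP; rewrite -normr_le0.
  by rewrite (le_trans (norm_op_modulus x0 lP P0))// (Jx0 : P (modulus x0) = 0) normr0.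
Qed.

Lemma eq_of_growth_rate_eq S T k : pos_op S -> pos_op T -> op_le S T ->
  irreducible_op S -> compact_op (iter k T) ->
  0 < growth_rate T -> growth_rate S = growth_rate T -> forall x, S x = T x.
Proof.
move=> Sp Tp ST Sirr Tk; set r := growth_rate T => r0 rS.
have [lS S0 _] := Sp; have [lT T0 _] := Tp.
have Skp := pos_op_iter k Sp; have Tkp := pos_op_iter k Tp.
have [lSk Sk0 _] := Skp; have [lTk Tk0 _] := Tkp.
have rk0 : 0 < r ^+ k by rewrite exprn_gt0.
have [P [Pp _ PT Pn0]] := krein_rutman Tp r0 Tk; rewrite -/r in PT.
(* The null ideal of [P] is [S]-invariant, as [P (S x) <= P (T x) = r P x] for positive [x]. *)
have Pinj x : 0 <=v x -> P x = 0 -> x = 0.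
  have [lP P0 _] := Pp.
  apply: (null_ideal_trivial Sirr Pp lS Pn0) => {}x x0 Px.
  apply: vle_anti; rewrite (P0 _ (S0 _ x0)) andbT.
  have -> : 0 = P (T x) by rewrite PT Px scaler0.
  by apply: (op_ge0_le lP P0); rewrite vle_subE; exact: ST.
have [U [UU oU]] := free_ultrafilter.
have /choice[u uP] : forall n : nat, exists u : E, [/\ 0 <=v u, `|u| <= 1, 2^-1 < `|u| &
    `|S u - r *: u| <= harmonic n].
  move=> n; have [||Q [Qp Q1 _ Qe [y [y0 y1 Qy]]]] :=
    approximate_eigenprojection Sp _ (e := harmonic n); rewrite ?rS ?invr_gt0//.
  exists (Q y); split => //; first by case: Qp => _ h _; exact: h.
    by rewrite (le_trans (Q1 y))// mul1r.
  by have := Qe y; rewrite rS => /le_trans; apply; rewrite ler_piMr// invr_ge0.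
have u0 n : 0 <=v u n by case: (uP n).
have Su1 : (fun n => S (u n) - r *: u n) @ U --> 0.
  apply: (@norm_le_cvg0 _ _ _ _ _ harmonic); first by move=> n; case: (uP n).
  by move=> A /cvg_harmonic; exact: oU.
have Su : (fun n => iter k S (u n) - r ^+ k *: u n) @ U --> 0 by exact: iter_eigen_cvg0.
have [|w Tw] := @compact_op_ultra_cvg _ _ (iter k T) 1 _ U u UU lTk Tk.
  by move=> n; case: (uP n).
pose d n := iter k T (u n) - iter k S (u n).
have d0 n : 0 <=v d n by rewrite -vle_subE; exact: iter_op_le.
(* [h] tends to 0: [T^k (u n)] tends to [w], and [S^k (u n) = T^k (u n) - d n] is close to
   [r^k u n]. Applying [T^k] to [h] isolates [T^k (d n)]. *)
pose h n := r ^+ k *: u n - w + d n.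
have h0 : h @ U --> 0.
  rewrite (_ : h = fun n => (iter k T (u n) - w) - (iter k S (u n) - r ^+ k *: u n)).
    rewrite -[X in _ --> X](subrr 0); apply: cvgB => //.
    by rewrite -[X in _ --> X](subrr w); apply: cvgB => //; exact: cvg_cst.
  apply/funext => n; rewrite /h /d opprB addrACA [in RHS]addrACA.
  by rewrite [r ^+ k *: _ + _]addrC.
have Td : (fun n => iter k T (d n)) @ U --> iter k T w - r ^+ k *: w.
  rewrite (_ : (fun n => _) = (fun n => iter k T (h n)
      - r ^+ k *: iter k T (u n) + iter k T w)).
    rewrite [X in _ --> X](_ : _ = iter k T 0 - r ^+ k *: w + iter k T w); last first.
      by rewrite (lin0 lTk) sub0r addrC.
    apply: cvgD; last exact: cvg_cst.
    by apply: cvgB; [exact: pos_op_cvg|by apply: cvgZl_tmp].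
  apply/funext => n; rewrite /h (linD lTk _ (d n)) (linB lTk _ w) (linZ lTk).
  by rewrite addrAC [_ - _ + _ + _]addrAC subrK addrAC subrr add0r.
have PTk x : P (iter k T x) = r ^+ k *: P x.
  elim: k {Tk Skp Tkp lSk Sk0 lTk Tk0 rk0 Su Tw d d0 h h0 Td} => [|m IH].
    by rewrite scale1r.
  by rewrite iterS PT IH scalerA -exprS.
(* T^k w - r^k w is positive, being the limit of T^k (d n), and P kills it. *)
have Tkw : iter k T w = r ^+ k *: w.
  have [lP _ _] := Pp.
  apply/eqP; rewrite -subr_eq0; apply/eqP; apply: Pinj.
    by apply: (vge0_lim _ Td) => n; exact: Tk0.
  by rewrite (linB lP) PTk (linZ lP) subrr.
rewrite Tkw subrr in Td.
have Sd : (fun n => iter k S (d n)) @ U --> 0.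
  apply: (@norm_le_cvg0 _ _ _ _ _ (fun n => `|iter k T (d n)|)); last exact/norm_cvg0P.
  by move=> n; apply: norm_le_ge0; [exact: Sk0|exact: iter_op_le].
(* Applying [S^k] to [h], with [S^k (d n)] now negligible, shows that [r^k S^k (u n)] tends to
   [S^k w]. As [S^k (u n)] is close to [r^k u n], dividing by [r^k] twice gives the limit of [u]. *)
pose v := (r ^+ k)^-1 *: ((r ^+ k)^-1 *: iter k S w).
have uv : u @ U --> v.
  have e n : u n = (r ^+ k)^-1 *: ((r ^+ k)^-1 *: (iter k S (h n) + iter k S w
      - iter k S (d n)) - (iter k S (u n) - r ^+ k *: u n)).
    have -> : iter k S (h n) + iter k S w - iter k S (d n) = r ^+ k *: iter k S (u n).
      rewrite /h (linD lSk _ (d n)) (linB lSk _ w) (linZ lSk).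
      by rewrite addrAC addrK subrK.
    by rewrite !scalerA mulVf ?gt_eqF// scale1r subKr scalerA mulVf ?gt_eqF// scale1r.
  rewrite (funext e).
  apply: cvgZl_tmp; rewrite -[X in _ --> X]subr0; apply: cvgB => //.
  apply: cvgZl_tmp; rewrite -[X in _ --> X]subr0; apply: cvgB => //.
  rewrite -[X in _ --> X]add0r; apply: cvgD; last exact: cvg_cst.
  by rewrite -[X in _ --> X](lin0 lSk); exact: pos_op_cvg.
clearbody v.
have v0 : 0 <=v v by exact: (vge0_lim u0 uv).
have vn0 : v != 0.
  apply/eqP => vE; rewrite vE in uv.
  have /filter_ex[n] : \forall n \near U, `|u n| < 2^-1.
    by move/cvgr0Pnorm_lt : uv; apply; rewrite invr_gt0.
  by case: (uP n) => _ _ /lt_trans h' _ /h'; rewrite ltxx.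
have Sv : S v = r *: v.
  apply/eqP; rewrite -subr_eq0; apply/eqP.
  have Su1' : (fun n => S (u n) - r *: u n) @ U --> S v - r *: v.
    by apply: cvgB; [exact: pos_op_cvg|by apply: cvgZl_tmp].
  by rewrite -(cvg_lim (@norm_hausdorff _ _) Su1'); apply/cvg_lim.
have TSv : T v = S v.
  apply/eqP; rewrite -subr_eq0; apply/eqP; apply: Pinj; first exact: ST.
  by have [lP _ _] := Pp; rewrite (linB lP) PT Sv (linZ lP) subrr.
have [M M0 TM] : exists2 M : R, 0 < M & bounded_by M T by case: Tp.
have TS x : 0 <=v x -> T x = S x.
  move=> x0; apply/eqP; rewrite -subr_eq0 -normr_le0; apply/ler_addgt0Pr => e e0.
  rewrite add0r.
  pose D : set E := [set c *: v | c in [set c : R | 0 <= c]].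
  have [|||||_ [c c0 <-] xc] :=
    @irreducible_dense _ _ S D v Sp Sirr _ _ _ _ v0 vn0 x (e / M).
  - move=> _ _ [a a0 <-] [b b0 <-]; exists (a + b); rewrite ?scalerDl//=.
    exact: addr_ge0.
  - move=> a _ a0 [b b0 <-]; exists (a * b); rewrite ?scalerA//=.
    exact: mulr_ge0.
  - move=> _ [a a0 <-]; exists (a * r); first by apply: mulr_ge0 => //; exact: ltW.
    by rewrite (linZ lS) Sv scalerA.
  - by exists 1; rewrite ?scale1r//=.
  - by rewrite divr_gt0.
  rewrite ge0_modulus// in xc; set p := pospart _ in xc.
  have TSlin y z : T y - S y + (T z - S z) = T (y + z) - S (y + z).
    by rewrite (linD lT) (linD lS) opprD addrACA.
  (* [x <= p + c v] and [T - S] is positive and kills [v], so [(T - S) x <= (T - S) p <= T p], and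
     [p] is small. *)
  have xp : T x - S x <=v T p.
    apply: (@vletrans _ _ (T p - S p)); last first.
      rewrite -[X in _ <=v X]subr0; apply: vleD; first exact: vle_refl.
      by rewrite vle_oppE; apply: S0; exact: pospart_ge0.
    have -> : T p - S p = T (p + c *: v) - S (p + c *: v).
      by rewrite -TSlin (linZ lT) (linZ lS) TSv subrr addr0.
    rewrite vle_subE; have -> : T (p + c *: v) - S (p + c *: v) - (T x - S x) =
        T (p + c *: v - x) - S (p + c *: v - x).
      by rewrite (linB lT) (linB lS) !opprB addrACA [in RHS]addrACA [- S _ + _]addrC.
    apply: ST; rewrite -vle_subE -[x](subrK (c *: v)); apply: vleD; last exact: vle_refl.
    exact: pospart_ge.
  apply: (le_trans (norm_le_ge0 (ST _ x0) xp)); apply: (le_trans (TM _)).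
  by rewrite mulrC -ler_pdivlMr// ltW.
move=> x; apply/eqP; rewrite eq_sym -subr_eq0 -normr_le0.
have lB : linear (fun x => T x - S x).
  by move=> a y z; rewrite lT lS scalerBr opprD addrACA.
by rewrite (le_trans (norm_op_modulus x lB ST))//= TS ?modulus_ge0// subrr normr0.
Qed.

End Domination.

(** * Positivity of the growth rate *)

Section DePagter.
Context {R : realType} {E : banachLatticeType R}.
Implicit Types (A B : E -> E) (x y z u : E).

(** Each point of [C] has an operator that works near it, as do all larger ones. Compactness, used
    with the filter of tails of the directed set [D], yields one operator for all of [C]. *)
Lemma near_covering_directed (C : set E) (D : set (E -> E)) (P : (E -> E) -> set E) :
  compact C -> D !=set0 ->
  (forall A B, D A -> D B -> exists2 A', D A' & op_le A A' /\ op_le B A') ->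
  (forall z, C z -> exists2 A, D A &
    \forall z' \near z, forall B, D B -> op_le A B -> P B z') ->
  exists2 A, D A & C `<=` P A.
Proof.
move=> /compact_near_coveringP Ccov [A0 DA0] Ddir DP.
pose G A := [set B | D B /\ op_le A B].
have FF : Filter (filter_from D G).
  apply: filter_from_filter; first by exists A0.
  move=> A B DA DB; have [A' DA' [AA' BA']] := Ddir _ _ DA DB.
  have tr A1 A2 A3 : op_le A1 A2 -> op_le A2 A3 -> op_le A1 A3.
    move=> h1 h2 x x0; rewrite -vle_subE; apply: (@vletrans _ _ (A2 x)).
      by rewrite vle_subE; exact: h1.
    by rewrite vle_subE; exact: h2.
  by exists A' => // A1 [DA1 A1A']; split; split => //; [exact: tr AA' _|exact: tr BA' _].
have [|A DA AP] := Ccov _ (filter_from D G) P FF.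
  move=> z Cz; have [A DA nz] := DP z Cz.
  exists ([set z' | forall B, D B -> op_le A B -> P B z'], G A) => /=.
    by split=> //; exists A.
  by move=> [z' B] [/= h [DB AB]]; exact: h.
exists A => //; apply: AP; split => // x x0; rewrite subrr; exact: vle_refl.
Qed.

Lemma growth_rate_gt0 (T : E -> E) k : pos_op T -> irreducible_op T ->
  compact_op (iter k.+1 T) -> 0 < growth_rate T.
Proof.
move=> Tp Tirr [C KC [Ccpt _]]; have [lT T0 _] := Tp.
set K := iter k.+1 T in KC.
have Kp : pos_op K by exact: pos_op_iter.
have [lK K0 [M M0 KM]] := Kp.
(* The null ideal of [T] itself is [T]-invariant; hence all powers of [T] are injective on the
   positive cone. *)
have Tinj x : 0 <=v x -> T x = 0 -> x = 0.
  apply: (null_ideal_trivial Tirr Tp lT); first by case: Tirr.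
  by move=> {}x _ ->; rewrite (lin0 lT).
have [x0 [x00 x01 Kx0]] : exists x0 : E, [/\ 0 <=v x0, `|x0| = 1 & K x0 != 0].
  have [[x1 Tx1] _ _] := Tirr.
  have x1n0 : x1 != 0 by apply: contra Tx1 => /eqP ->; rewrite (lin0 lT).
  have nx1 : 0 < `|x1| by rewrite normr_gt0.
  have m0 : 0 <=v `|x1|^-1 *: modulus x1.
    by apply: vle_scale; [rewrite invr_ge0|exact: modulus_ge0].
  exists (`|x1|^-1 *: modulus x1); split => //.
    by rewrite normrZ norm_modulus gtr0_norm ?invr_gt0// mulVf// gt_eqF.
  apply/eqP => Kx1.
  have : `|x1|^-1 *: modulus x1 = 0.
    move: Kx1; rewrite /K; elim: k.+1 => // n IH; rewrite iterS => h.
    apply: IH; apply: Tinj h.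
    by have [_ + _] := pos_op_iter n Tp; apply.
  move/eqP; rewrite scaler_eq0 invr_eq0 gt_eqF//= => /eqP /modulus_eq0 /eqP.
  by rewrite (negbTE x1n0).
have b0 : 0 < `|K x0| by rewrite normr_gt0.
(* [d <= 1 / 2] keeps vectors within [d] of [x0] away from 0, and [d M < |K x0|] makes the first
   alternative of [P] below hold near 0 but fail at [K u] for [u] within [d] of [x0]. *)
have [d [d0 d2 dM]] : exists d : R, [/\ 0 < d, d <= 2^-1 & d * M < `|K x0|].
  exists (Num.min 2^-1 (`|K x0| / M / 2)); split.
  - by rewrite lt_min invr_gt0 !divr_gt0 ?andbT.
  - by rewrite ge_min lexx.
  - rewrite -ltr_pdivlMr//; apply: (@le_lt_trans _ _ (`|K x0| / M / 2)).
      by rewrite ge_min lexx orbT.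
    by rewrite ltr_pdivrMr// mulr_natr mulr2n ltrDl divr_gt0.
(* The positive commutant of [T]. Its values at a positive nonzero vector satisfy the hypotheses of
   [irreducible_dense], and sums make it directed. *)
pose D : set (E -> E) := [set A | pos_op A /\ forall x, A (T x) = T (A x)].
(* The first alternative discards the points of C far from K x0, such as 0. *)
pose P A z := d * M < `|K x0 - z| \/ `|pospart (x0 - A (modulus z))| < d.
have DD A B : D A -> D B -> D (fun x => A x + B x).
  move=> [Ap AT] [Bp BT]; split; first exact: pos_op_add.
  by move=> x; rewrite AT BT (linD lT).
have [A [Ap AT] AP] : exists2 A, D A & C `<=` P A.
  apply: near_covering_directed => //.
  - by exists id; split => //; exact: pos_op_id.
  - move=> A B DA DB; exists (fun x => A x + B x); first exact: DD.
    have [[[_ A0 _] _] [[_ B0 _] _]] := (DA, DB).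
    by split => x xge0; rewrite ?addrK ?[A x + _]addrC ?addrK; [exact: B0|exact: A0].
  - move=> z _; have [->|z0] := eqVneq z 0.
      exists id; first by split => //; exact: pos_op_id.
      have : \forall z' \near (0 : E), `|z'| < `|K x0| - d * M.
        by apply: (@cvgr0_norm_lt _ _ _ _ _ id); rewrite ?subr_gt0//; exact: cvg_id.
      apply: filterS => z' hz' B _ _; left.
      rewrite ltrBrDr addrC -ltrBrDr in hz'.
      by apply: (lt_le_trans hz'); exact: lerB_dist.
    have m0 : modulus z != 0 by apply: contra z0 => /eqP/modulus_eq0 ->.
    have [||||_ [A DA <-] Az] := @irreducible_dense _ _ T [set A (modulus z) | A in D]
      (modulus z) Tp Tirr _ _ _ _ (modulus_ge0 z) m0 x0 d d0.
    + move=> _ _ [A DA <-] [B DB <-]; exists (fun x => A x + B x) => //; exact: DD.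
    + move=> a _ a0 [A [Ap AT] <-]; exists (fun x => a *: A x) => //; split.
        exact: pos_op_scale.
      by move=> x; rewrite AT (linZ lT).
    + move=> _ [A [Ap AT] <-]; exists (T \o A) => //; split; first exact: pos_op_comp.
      by move=> x /=; rewrite AT.
    + by exists id => //; split => //; exact: pos_op_id.
    rewrite ge0_modulus// in Az; exists A => //.
    have [[lA A0 [N N0 AN]] _] := DA.
    (* The radius is the slack in the strict inequality for [z], divided by the bound of [A]; a
       larger [B] only decreases the positive part. *)
    have : \forall z' \near z, `|z - z'| < (d - `|pospart (x0 - A (modulus z))|) / N.
      apply: (@cvgr_dist_lt _ _ _ _ _ id); first exact: cvg_id.
      by rewrite divr_gt0 ?subr_gt0.
    apply: filterS => z' hz' B _ AB; right.
    rewrite ltr_pdivlMr// ltrBrDl in hz'; apply: le_lt_trans hz'.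
    rewrite mulrC; apply: (@le_trans _ _
        `|pospart (x0 - A (modulus z)) + A (modulus (z - z'))|).
      apply: norm_le_ge0; first exact: pospart_ge0.
      apply: pospart_le; last first.
        by apply: vaddr_ge0; [exact: pospart_ge0|apply: A0; exact: modulus_ge0].
      apply: (@vletrans _ _ (x0 - A (modulus z'))).
        apply: vleD; first exact: vle_refl.
        by rewrite vle_oppE vle_subE; apply: AB; exact: modulus_ge0.
      apply: (@vletrans _ _ (x0 - A (modulus z) + A (modulus (z - z')))); last first.
        by apply: vleD; [exact: pospart_ge|exact: vle_refl].
      rewrite vle_subE (_ : _ - (_ - _) =
          A (modulus z' + modulus (z - z')) - A (modulus z)); last first.
        by rewrite (linD lA) opprB addrC !addrA subrK addrAC.
      rewrite -vle_subE; apply: op_ge0_le => //.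
      by rewrite -{1}(subrK z' z) addrC; exact: modulusD.
    by apply: (le_trans (ler_normD _ _)); rewrite lerD2l (le_trans (AN _))// norm_modulus.
have [lA A0 [a a0 Aa]] := Ap.
(* This is the infimum of [x0] and [A (K u)]. *)
pose W u := x0 - pospart (x0 - A (K u)).
pose U : set E := [set u | [/\ 0 <=v u, u <=v x0 & `|x0 - u| <= d]].
have UW u : U u -> U (W u).
  move=> [u0 ux0 ud]; have AKu0 : 0 <=v A (K u) by apply: A0; exact: K0.
  rewrite /U/W/=; split.
  - rewrite -vle_subE; apply: pospart_le => //.
    by rewrite vle_subE opprB addrC subrK.
  - by rewrite vle_subE subKr; exact: pospart_ge0.
  - rewrite subKr; have [|h|] := AP (K u).
    + by apply: KC; exists u => //=; rewrite -x01; exact: norm_le_ge0.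
    + exfalso; move: h; apply/negP; rewrite -leNgt -(linB lK) mulrC.
      by apply: (le_trans (KM _)); rewrite ler_pM2l.
    + by rewrite ge0_modulus ?(K0 _ u0)// => /ltW.
have WAK u : W u <=v A (K u).
  by rewrite /W vle_subE opprB addrCA -[_ - x0]opprB -vle_subE; exact: pospart_ge.
have AKp : pos_op (A \o K) by exact: pos_op_comp.
have [lAK AK0 _] := AKp.
have Ux0 : U x0 by split; rewrite ?vle_refl// subrr normr0 ltW.
have UWm m : U (iter m W x0) by elim: m => //= m; exact: UW.
have WAKm m : iter m W x0 <=v iter m (A \o K) x0.
  elim: m => [|m IH]; first exact: vle_refl.
  by rewrite !iterS; apply: (vletrans (WAK _)); exact: (op_ge0_le lAK AK0 IH).
have AKm m x : iter m (A \o K) x = iter m A (iter (m * k.+1) T x).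
  have AT' n y : A (iter n T y) = iter n T (A y) by elim: n => //= n <-.
  have ATm m' n y : iter m' A (iter n T y) = iter n T (iter m' A y).
    by elim: m' => //= m' ->.
  elim: m => // m IH; rewrite iterS IH mulSn iterD.
  by rewrite [RHS]iterS (ATm m k.+1).
(* The iterates of [W] stay within 1/2 of the unit vector [x0] and below [(A K)^m x0], which is
   [A^m K^m x0] because [A] commutes with [T]. *)
have lower m : 2^-1 <= a ^+ m * `|iter (m * k.+1) T x0|.
  have [Wm0 _ Wmd] := UWm m.
  have Am y : `|iter m A y| <= a ^+ m * `|y|.
    elim: m {Wm0 Wmd} => [|m IH]; first by rewrite mul1r.
    by rewrite iterS exprS -mulrA (le_trans (Aa _))// ler_pM2l.
  apply: le_trans (Am _); rewrite -AKm; apply: le_trans (norm_le_ge0 Wm0 (WAKm m)).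
  have := lerB_dist x0 (x0 - iter m W x0); rewrite subKr x01 => /(le_trans _); apply.
  by rewrite lerBrDr -lerBrDl (le_trans Wmd)// (le_trans d2)// {2}(splitr 1) div1r addrK.
rewrite ltNge; apply/negP => r0.
(* A zero growth rate admits every [l > 0]. With [l <= 1] the power [l^(m (k + 1))] is at most
   [l^m], the exponent [k.+1] being positive, and [a l <= 1 / 2] makes the upper bound decay. *)
have [l [l0 l1 la]] : exists l : R, [/\ 0 < l, l <= 1 & a * l <= 2^-1].
  exists (Num.min 1 (a^-1 / 2)); split.
  - by rewrite lt_min ltr01 divr_gt0// invr_gt0.
  - by rewrite ge_min lexx.
  - by rewrite mulrC -ler_pdivlMr// mulrC ge_min lexx orbT.
have [_ [c c0 Tc]] := growth_rate_lt Tp (le_lt_trans r0 l0).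
have upper m : 2^-1 <= c * 2^-1 ^+ m.
  apply: (le_trans (lower m)); apply: (@le_trans _ _ (a ^+ m * (c * l ^+ m))).
    rewrite ler_pM2l ?exprn_gt0// (le_trans (Tc _ _))// x01 mulr1 ler_wpM2l//.
    by apply: ler_wiXn2l => //; [exact: ltW|rewrite leq_pmulr].
  rewrite mulrCA ler_wpM2l// -exprMn.
  by rewrite lerXn2r ?nnegrE ?invr_ge0// mulr_ge0 ?ltW.
have /cvgrPdist_lt : geometric c (2^-1 : R) @ \oo --> (0 : R).
  by apply: cvg_geometric; rewrite ger0_norm ?invr_ge0// invf_lt1// ltr1n.
move=> /(_ 2^-1); rewrite invr_gt0 => /(_ (ltr0Sn _ _)) /filter_ex[m].
rewrite sub0r normrN ger0_norm; last by rewrite mulr_ge0 ?exprn_ge0 ?invr_ge0.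
by rewrite ltNge => /negP; apply; exact: upper.
Qed.

End DePagter.

(** * The spectral radius *)

(* Without this, products of complete normed modules lack the joins of pointed
   and uniform structures that completeness requires. *)
HB.saturate prod.

Section ProductComplete.
Context {R : realType} {U V : completeNormedModType R}.

(** Makes [E * E] complete, so that the Neumann series on the complexification can be summed
    there. *)
Lemma prod_cauchy_cvg (F : set_system (U * V)) : ProperFilter F -> cauchy F -> cvg F.
Proof.
move=> FF /cauchyP Fc.
have F1 : cauchy_ex (fst @ F).
  move=> e e0; have [z Fz] := Fc e e0; exists z.1.
  suff : F (fst @^-1` ball z.1 e) by [].
  by apply: (filterS _ Fz) => w [].
have F2 : cauchy_ex (snd @ F).
  move=> e e0; have [z Fz] := Fc e e0; exists z.2.
  suff : F (snd @^-1` ball z.2 e) by [].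
  by apply: (filterS _ Fz) => w [].
have c1 : cvg (fst @ F) by apply: cauchy_cvg; exact: cauchy_exP.
have c2 : cvg (snd @ F) by apply: cauchy_cvg; exact: cauchy_exP.
apply/cvg_ex; exists (lim (fst @ F), lim (snd @ F)).
have h := cvg_pair c1 c2.
move=> A /h FA.
by apply: (@filterS _ F _ ((fun z => (z.1, z.2)) @^-1` A)) => // -[].
Qed.

HB.instance Definition _ := Uniform_isComplete.Build (U * V)%type prod_cauchy_cvg.

End ProductComplete.

Section SpectralRadius.
Context {R : realType} {E : banachLatticeType R}.
Implicit Types (S T : E -> E) (l : R[i]).

Lemma normr_Re_le l : `|complex.Re l| <= Normc.normc l.
Proof.
by case: l => a b /=; rewrite -sqrtr_sqr ler_wsqrtr// lerDl sqr_ge0.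
Qed.

Lemma normr_Im_le l : `|complex.Im l| <= Normc.normc l.
Proof.
by case: l => a b /=; rewrite -sqrtr_sqr ler_wsqrtr// lerDr sqr_ge0.
Qed.

Lemma normc_ge0 l : 0 <= Normc.normc l.
Proof. by case: l => a b /=; exact: sqrtr_ge0. Qed.

Lemma normcX l n : Normc.normc (l ^+ n) = Normc.normc l ^+ n.
Proof. by elim: n => [|n IH]; rewrite ?Normc.normc1// !exprS Normc.normcM IH. Qed.

(** Complex scaling seen as a real linear map of the normed product, to which [neumann] applies. *)
Let sc l (z : E * E) : E * E := complexification_scale l z.

Let sc_lin l : linear (sc l).
Proof.
move=> a x y; rewrite /sc /complexification_scale.
have fstZ (z : E * E) : (a *: z).1 = a *: z.1 by [].
have sndZ (z : E * E) : (a *: z).2 = a *: z.2 by [].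
congr pair; rewrite /= ?fstZ ?sndZ /=;
  by rewrite !(scalerDr, scalerN, opprD, scalerA) addrACA !(mulrC a).
Qed.

(** The product carries the max norm and each component of the result has two terms, hence the
    factor 2. *)
Let sc_bnd l : bounded_by (2 * Normc.normc l) (sc l).
Proof.
move=> z; rewrite prod_normE/= ge_max.
have z1 : `|z.1| <= `|z| by rewrite prod_normE le_max lexx.
have z2 : `|z.2| <= `|z| by rewrite prod_normE le_max lexx orbT.
have b c u : `|c| <= Normc.normc l -> `|u : E| <= `|z| ->
    `|c *: u| <= Normc.normc l * `|z|.
  by move=> cl uz; rewrite normrZ ler_pM.
rewrite -mulrA mulr_natl mulr2n (le_trans (ler_normB _ _)) ?(le_trans (ler_normD _ _))//;
  by rewrite lerD// b// ?normr_Re_le ?normr_Im_le.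
Qed.

(** Factor [l - S] as [l (1 - S / l)]. The iterates of [f = S / l] are [l^-n S^n], which decay like
    [(m / |l|)^n] for [m] between the growth rate and [|l|]. *)
Lemma resolvent_set_growth S l : pos_op S -> growth_rate S < Normc.normc l ->
  resolvent_set (complexify S : complexification E -> _) l.
Proof.
move=> Sp Sl; have [lS _ _] := Sp.
have l0 : 0 < Normc.normc l by apply: le_lt_trans Sl; exact: growth_rate_ge0.
have ln0 : l != 0.
  by apply/eqP => lE; rewrite lE Normc.normc0 ltxx in l0.
have [m [Sm ml]] : exists m, growth_rate S < m /\ m < Normc.normc l.
  by exists ((growth_rate S + Normc.normc l) / 2); rewrite !midf_lt.
have [m0 [C C0 SC]] := growth_rate_lt Sp Sm.
pose f (z : E * E) : E * E := sc l^-1 (complexify S z).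
have lf : linear f.
  move=> a x y; rewrite -sc_lin /f; congr sc.
  by rewrite /complexify/=; congr pair; exact: lS.
have f_iter n z : iter n f z = sc (l^-1 ^+ n) (iter n S z.1, iter n S z.2).
  elim: n => [|n IH].
    by rewrite -[RHS]/(1 *: (z : complexification E)) scale1r.
  rewrite iterS IH exprS -[RHS]/(_ *: (_ : complexification E)) -scalerA.
  rewrite /f; congr sc; rewrite /complexify /sc /complexification_scale/=.
  by rewrite (linB lS) (linD lS) !(linZ lS).
have [||||g [lg gC gK Kg _]] := @neumann _ (E * E)%type f (2 * C) (m / Normc.normc l) lf.
- by rewrite mulr_ge0.
- by rewrite divr_ge0 ?normc_ge0 ?ltW.
- by rewrite ltr_pdivrMr// mul1r.
- move=> n z; rewrite f_iter; apply: (le_trans (sc_bnd _ _)).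
  rewrite normcX Normc.normcV.
  rewrite (_ : _ * `|z| = 2 * (Normc.normc l)^-1 ^+ n * (C * m ^+ n * `|z|)); last first.
    by rewrite exprMn; ring.
  apply: ler_wpM2l; first by rewrite mulr_ge0// exprn_ge0// invr_ge0 ltW.
  have z1 : `|z.1| <= `|z| by rewrite prod_normE le_max lexx.
  have z2 : `|z.2| <= `|z| by rewrite prod_normE le_max lexx orbT.
  rewrite prod_normE/= ge_max !(le_trans (SC _ _)) ?ler_wpM2l//.
    by rewrite mulr_ge0// exprn_ge0// ltW.
  by rewrite mulr_ge0// exprn_ge0// ltW.
have e : forall z : complexification E,
    l *: z - complexify S z = l *: (z - (f z : complexification E)).
  by move=> z; rewrite scalerBr -[f z]/(l^-1 *: (complexify S z : complexification E))
    scalerA divff// scale1r.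
exists (fun z => g (sc l^-1 z)); split.
- move=> z; apply: (bounded_by_cvg lg gC).
  exact: (bounded_by_cvg (sc_lin l^-1) (sc_bnd l^-1) cvg_id).
- move=> z; rewrite e -[sc _ _]/(l^-1 *: (l *: (_ : complexification E))).
  by rewrite scalerA mulVf// scale1r; exact: gK.
- move=> z; rewrite e [_ - _]Kg -[sc _ _]/(l^-1 *: (_ : complexification E)).
  by rewrite scalerA divff// scale1r.
Qed.

Lemma spectral_radius_le S : pos_op S -> (spectral_radius S <= (growth_rate S)%:E)%E.
Proof.
move=> Sp; apply: ub_ereal_sup => _ [l Sl <-]; rewrite lee_fin leNgt.
by apply/negP => h; apply: Sl; exact: resolvent_set_growth.
Qed.

Lemma spectral_radius_ge S (r : R) (x : E) :
  linear S -> 0 <= r -> x != 0 -> S x = r *: x ->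
  (r%:E <= spectral_radius S)%E.
Proof.
move=> lS r0 x0 Sx; apply: ereal_sup_ubound; exists (r%:C)%C; last first.
  by rewrite /= expr0n addr0 sqrtr_sqr ger0_norm.
move=> [g [_ gK _]].
(* [g] is only known to be a left inverse, so [(x, 0)] and 0 are compared through their equal images
   under [r - S]. *)
have h0 : ((r%:C)%C *: ((x, 0) : complexification E) - complexify S (x, 0)) =
    (r%:C)%C *: (0 : complexification E) - complexify S 0.
  congr pair => /=; rewrite /complexify/= ?Sx ?(lin0 lS) ?scale0r ?scaler0 ?subr0
    ?addr0//.
  by rewrite subrr.
have : ((x, 0) : complexification E) = 0.
  by rewrite -[LHS]gK -[RHS]gK /= h0.
by move=> /(congr1 fst) /= xE; move: x0; rewrite xE eqxx.
Qed.

End SpectralRadius.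

(** Supplies the positive exponent that [growth_rate_gt0] asks for, including when the given
    exponent is 0. *)
Lemma compact_op_iterS (R : realType) (E : banachLatticeType R) (T : E -> E) k :
  continuous T -> compact_op (iter k T) -> compact_op (iter k.+1 T).
Proof.
move=> cT [C KC [Ccpt _]].
have TC : compact (T @` C).
  by apply: continuous_compact => //; exact: continuous_subspaceT.
exists (T @` C); last by split => //; exact: compact_closed.
by move=> _ [x x1 <-]; exists (iter k T x) => //; apply: KC; exists x.
Qed.

Theorem theorem2p1 (R : realType) (E : banachLatticeType R)
  (S T : {linear E -> E}) (S_cont : continuous S) (T_cont : continuous T)
  (S_ge0 : op_ge0 S) (S_le_T : op_le S T)
  (S_irr : irreducible_op S)
  (T_power_compact : exists k : nat, compact_op (iter k T)) :
  (spectral_radius S <= spectral_radius T)%E /\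
  (spectral_radius S = spectral_radius T <-> S = T :> (E -> E)).
Proof.
have [k Tk] := T_power_compact.
have Sp := pos_op_of_continuous S_cont S_ge0.
have T_ge0 : op_ge0 T.
  by move=> x x0; apply: (vletrans (S_ge0 x x0)); rewrite vle_subE; exact: S_le_T.
have Tp := pos_op_of_continuous T_cont T_ge0.
have T_irr := irreducible_le Sp Tp S_le_T S_irr.
have r0 := growth_rate_gt0 Tp T_irr (compact_op_iterS T_cont Tk).
have [P [Pp TP _ [x Px]]] := krein_rutman Tp r0 Tk.
have rT : ((growth_rate T)%:E <= spectral_radius T)%E.
  by case: (Tp) => lT _ _; exact: (spectral_radius_ge lT (ltW r0) Px (TP x)).
have rS := spectral_radius_le Sp.
have rST := growth_rate_mono Sp Tp S_le_T.
split; first by rewrite (le_trans rS)// (le_trans _ rT)// lee_fin.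
split=> [e|->//]; apply/funext.
apply: (eq_of_growth_rate_eq Sp Tp S_le_T S_irr Tk r0).
(* The growth rate of [T] is at most its spectral radius, which is that of [S] and so at most the
   growth rate of [S]. *)
apply/eqP; rewrite eq_le rST/= -lee_fin.
by rewrite (le_trans rT)// -e.
Qed.
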